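(* Let $F_m$ be the free group of rank $m\ge 2$ with a finite generating set $X$. Let $\gamma_1,\dots,\gamma_n\in F_m$ be nontrivial elements with $\|\gamma_j\|_X\le d$ for all $j$. Then $$\mathrm{lcm}_{F_m,X}(\gamma_1,\dots,\gamma_n)\le 6dn^2.$$
   Context: For a group $\Gamma$ with finite generating set $X$, $\|\cdot\|_X$ denotes word length with respect to $X$. For a finite set $S$ of nontrivial elements of $\Gamma$, let $L_S=\bigcap_{\gamma\in S}\overline{\langle\gamma\rangle}$, where $\overline{\langle\gamma\rangle}$ is the normal closure in $\Gamma$ of the cyclic subgroup generated by $\gamma$. Let $\mathrm{LCM}_{\Gamma,X}(S)$ be the set of nontrivial elements of $L_S$ of minimal word length among nontrivial elements of $L_S$. Define $\mathrm{lcm}_{\Gamma,X}(S)=\|\delta\|_X$ for any $\delta\in\mathrm{LCM}_{\Gamma,X}(S)$ if this set is nonempty, and $\mathrm{lcm}_{\Gamma,X}(S)=0$ if it is empty. Write $\mathrm{lcm}_{\Gamma,X}(\gamma_1,\dots,\gamma_n)=\mathrm{lcm}_{\Gamma,X}(\{\gamma_1,\dots,\gamma_n\})$. *)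

(* Defs.v *)
From HB Require Import structures.
From mathcomp Require Import all_boot.
From mathcomp Require Import boolp classical_sets cardinality.

Set Implicit Arguments.
Unset Strict Implicit.
Unset Printing Implicit Defensive.

Local Open Scope classical_set_scope.
Local Open Scope group_scope.

(* The free group on A is the set of reduced words in the letters a^{+1},     *)
(* a^{-1}, written (a, false) and (a, true); the product is concatenation     *)
(* followed by free reduction. The universal property is free_group_ump.      *)

Section ReducedWords.
Variable A : choiceType.
Implicit Types (u v : A * bool) (w x y : seq (A * bool)).

Definition letter_inv u : A * bool := (u.1, ~~ u.2).

Definition reduced w : bool := sorted (fun u v => v != letter_inv u) w.

Definition push_letter u w : seq (A * bool) :=
  if w is v :: w' then if v == letter_inv u then w' else u :: w else [:: u].

Definition word_mul w x : seq (A * bool) := foldr push_letter x w.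

Definition word_inv w : seq (A * bool) := rev (map letter_inv w).

Lemma letter_invK : involutive letter_inv.
Proof. by case=> a b; rewrite /letter_inv /= negbK. Qed.

Lemma reduced_push u w : reduced w -> reduced (push_letter u w).
Proof.
case: w => [//|v w] /= rw; case: eqP => [_|/eqP nvu]; first exact: path_sorted rw.
by rewrite /= nvu.
Qed.

Lemma reduced_mul w x : reduced x -> reduced (word_mul w x).
Proof. by move=> rx; elim: w => //= u w; apply: reduced_push. Qed.

Lemma push_letterK u w :
  reduced w -> push_letter u (push_letter (letter_inv u) w) = w.
Proof.
case: w => [_|v w] /=; first by rewrite eqxx.
rewrite letter_invK; case: eqP => [->|_ _] /=; last by rewrite eqxx.
by case: w => [//|v' w] /= /andP[/negPf ->].
Qed.

Lemma push_letter_mul u w x :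
  reduced x -> word_mul (push_letter u w) x = push_letter u (word_mul w x).
Proof.
case: w => [//|v w] rx /=; case: eqP => //= ->.
by rewrite push_letterK // reduced_mul.
Qed.

Lemma word_mulA w x y :
  reduced y -> word_mul w (word_mul x y) = word_mul (word_mul w x) y.
Proof. by move=> ry; elim: w => //= u w ->; rewrite push_letter_mul. Qed.

Lemma word_mulw0 w : reduced w -> word_mul w [::] = w.
Proof.
elim: w => //= u w IHw rw; rewrite IHw; last exact: path_sorted rw.
by case: w rw {IHw} => //= v w /andP[/negPf ->].
Qed.

Lemma word_mulV w : word_mul (word_inv w) w = [::].
Proof.
elim: w => //= u w IHw.
by rewrite /word_inv /= rev_cons /word_mul foldr_rcons /= letter_invK eqxx.
Qed.

Lemma word_invK : involutive word_inv.
Proof.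
move=> w; rewrite /word_inv map_rev revK -map_comp.
by rewrite (eq_map (g := id)) ?map_id // => u; exact: letter_invK.
Qed.

Lemma reduced_inv w : reduced w -> reduced (word_inv w).
Proof.
rewrite /reduced /word_inv rev_sorted sorted_map; apply: sub_sorted => u v /=.
by rewrite letter_invK; apply: contraNneq => <-.
Qed.

End ReducedWords.

Section FreeGroup.
Variable A : choiceType.

Record free_group := FreeGroup
  { free_word :> seq (A * bool); free_wordP : reduced free_word }.

HB.instance Definition _ := [isSub for free_word].
HB.instance Definition _ := [Choice of free_group by <:].

Implicit Types f g h : free_group.

Definition free_one : free_group := @FreeGroup [::] isT.
Definition free_mul f g : free_group :=
  FreeGroup (reduced_mul f (free_wordP g)).
Definition free_inv f : free_group := FreeGroup (reduced_inv (free_wordP f)).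
Definition free_gen (a : A) : free_group := @FreeGroup [:: (a, false)] isT.

Lemma free_mulA : associative free_mul.
Proof. by move=> f g h; apply: val_inj; apply: word_mulA (free_wordP h). Qed.

Lemma free_mul1g : left_id free_one free_mul.
Proof. by move=> f; apply: val_inj. Qed.

Lemma free_mulg1 : right_id free_one free_mul.
Proof. by move=> f; apply: val_inj; apply: word_mulw0 (free_wordP f). Qed.

Lemma free_mulVg : left_inverse free_one free_inv free_mul.
Proof. by move=> f; apply: val_inj; apply: word_mulV. Qed.

Lemma free_mulgV : right_inverse free_one free_inv free_mul.
Proof.
move=> f; apply: val_inj => /=.
by rewrite -[X in word_mul X]word_invK word_mulV.
Qed.

HB.instance Definition _ :=
  isGroup.Build free_group free_mulA free_mul1g free_mulg1 free_mulVg free_mulgV.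

End FreeGroup.

Section UniversalProperty.
Variables (A : choiceType) (H : groupType) (phi : A -> H).

Definition letter_val (u : A * bool) : H :=
  if u.2 then (phi u.1)^-1 else phi u.1.

Definition free_lift (f : free_group A) : H :=
  \prod_(u <- free_word f) letter_val u.

Lemma free_liftM : {morph free_lift : f g / f * g}.
Proof.
move=> f g; rewrite /free_lift /= /word_mul.
elim: (free_word f) => [|u w IHw] /=; first by rewrite big_nil mul1g.
rewrite big_cons -mulgA -IHw.
case: (foldr _ _ _) => [|v w'] /=; first by rewrite big_seq1 big_nil mulg1.
case: eqP => [->|_]; rewrite big_cons // mulgA.
by case: u => a [] /=; rewrite /letter_val /= ?mulVg ?mulgV mul1g.
Qed.

Lemma free_lift_gen a : free_lift (free_gen a) = phi a.
Proof. by rewrite /free_lift big_seq1. Qed.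

Lemma free_lift_uniq (psi : free_group A -> H) :
    {morph psi : f g / f * g} -> (forall a, psi (free_gen a) = phi a) ->
  psi =1 free_lift.
Proof.
move=> psiM psi_gen.
have psi1 : psi 1 = 1 by apply: (mulgI (psi 1)); rewrite -psiM !mulg1.
have psiV f : psi f^-1 = (psi f)^-1.
  by apply: (mulgI (psi f)); rewrite -psiM !mulgV.
have psi_letter (u : A * bool) :
    psi (FreeGroup (isT : reduced [:: u])) = letter_val u.
  case: u => a [] /=; rewrite /letter_val /= -psi_gen -?psiV;
  by congr (psi _); apply: val_inj.
case=> w; elim: w => [|u w IHw] rw; rewrite /free_lift /=.
  by rewrite big_nil -psi1; congr (psi _); apply: val_inj.
have rw' : reduced w by apply: path_sorted rw.
rewrite big_cons -psi_letter -[X in _ * X](IHw rw') -psiM; congr (psi _).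
apply: val_inj => /=.
by case: w rw {rw' IHw} => //= v w /andP[/negPf ->].
Qed.

End UniversalProperty.

Lemma free_group_ump (A : choiceType) (H : groupType) (phi : A -> H) :
  exists! psi : free_group A -> H,
    {morph psi : f g / f * g} /\ forall a, psi (free_gen a) = phi a.
Proof.
exists (free_lift phi); split=> [|psi [psiM psi_gen]].
  by split; [apply: free_liftM | apply: free_lift_gen].
by apply/funext => f; rewrite (free_lift_uniq psiM psi_gen).
Qed.

Section LeastCommonMultiples.
Variable G : groupType.
Implicit Types (X S H : set G) (g x y : G).

Definition subgroup H : Prop :=
  [/\ H 1, forall x y, H x -> H y -> H (x * y) & forall x, H x -> H x^-1].

Definition normal_subgroup H : Prop :=
  subgroup H /\ forall x g, H x -> H (x ^ g).

Definition generated X : set G := smallest subgroup X.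

Definition normal_closure X : set G := smallest normal_subgroup X.

Definition word_of X (g : G) (w : seq G) : Prop :=
  (forall x, x \in w -> X x \/ X x^-1) /\ \prod_(x <- w) x = g.

(* Equal to 0 by convention outside the subgroup generated by X. *)
Definition word_length X g : nat :=
  xget 0%N [set k | (exists2 w, word_of X g w & size w = k) /\
                    (forall w, word_of X g w -> k <= size w)%N].

Definition common_multiples S : set G :=
  \bigcap_(g in S) normal_closure (generated [set g]).

Definition LCM X S : set G :=
  [set x | [/\ common_multiples S x, x <> 1 &
     forall y, common_multiples S y -> y <> 1 ->
       (word_length X x <= word_length X y)%N]].

(* All elements of LCM X S have the same length; lcm_length X S is that       *)
(* length, and 0 when LCM X S is empty.                                       *)
Definition lcm_length X S : nat := xget 0%N (word_length X @` LCM X S).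

End LeastCommonMultiples.

(* Main.v *)
(* The commutator [~ f, h] lies in every normal subgroup containing f or h, so
   iterated commutators along a balanced binary tree produce common multiples of
   quadratic length. To keep them nontrivial, the second argument is conjugated
   by a generator when needed: if f commuted with g and with all g ^ x, x in X,
   then, commutation being transitive on nontrivial elements of a free group, the
   centralizer of g would be a nontrivial abelian normal subgroup.

   Commutation is transitive because the free group acts faithfully, up to
   scalars, by 2 x 2 matrices over Z[T]: the letter s maps to P_s + T P_(s^-1),
   where P_s and P_(s^-1) are complementary projections onto lines, distinct
   letters having distinct lines. At T = 0 a nonempty reduced word becomes a
   product of rank one matrices that is itself of rank one, hence is not scalar;
   and the centralizer of a nonscalar 2 x 2 matrix is commutative. *)

From HB Require Import structures.
From mathcomp Require Import all_boot all_algebra.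
From mathcomp Require Import boolp classical_sets cardinality.
From mathcomp Require Import ring zify.
Require Import Defs.

Set Implicit Arguments.
Unset Strict Implicit.
Unset Printing Implicit Defensive.

Import GRing.Theory.

Section TwoByTwo.
Local Open Scope ring_scope.
Variable R : idomainType.
Implicit Types A B C : 'M[R]_2.

Lemma mulmx2E A B i j : (A *m B) i j = A i 0 * B 0 j + A i 1 * B 1 j.
Proof.
rewrite mxE !big_ord_recl big_ord0 addr0.
by congr (A i _ * B _ j + A i _ * B _ j); apply: ord_inj.
Qed.

Lemma matrix2P A B :
  A 0 0 = B 0 0 -> A 0 1 = B 0 1 -> A 1 0 = B 1 0 -> A 1 1 = B 1 1 -> A = B.
Proof.
move=> e00 e01 e10 e11; apply/matrixP => i j.
have ord2 (k : 'I_2) : k = 0 \/ k = 1.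
  by case: k => [[|[|//]] k2]; [left | right]; apply: ord_inj.
by case: (ord2 i) => ->; case: (ord2 j) => ->.
Qed.

Definition traceless_coefs A : seq R := [:: A 0 1; A 1 0; A 0 0 - A 1 1].

Lemma is_scalar_mx2P A :
  (forall k, (traceless_coefs A)`_k = 0) -> is_scalar_mx A.
Proof.
move=> A0; apply/is_scalar_mxP; exists (A 0 0).
have /eqP := A0 2%N; rewrite /= subr_eq0 => /eqP e.
apply: matrix2P; rewrite [RHS]mxE /= ?mulr1n ?mulr0n //.
- exact: A0 0%N.
- exact: A0 1%N.
Qed.

Lemma comm_mx2P A B : A *m B = B *m A <->
  forall i j, (traceless_coefs A)`_i * (traceless_coefs B)`_j =
              (traceless_coefs B)`_i * (traceless_coefs A)`_j.
Proof.
split=> [AB | AB].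
  have ABE i j : (A *m B) i j - (B *m A) i j = 0 by rewrite AB subrr.
  have := ABE 0 0; have := ABE 0 1; have := ABE 1 0.
  rewrite !mulmx2E => e10 e01 e00.
  case=> [|[|[|i]]] [|[|[|j]]]; rewrite /= ?nth_nil ?mulr0 ?mul0r //;
    apply/eqP; rewrite -subr_eq0; apply/eqP.
  - by ring.
  - by rewrite -[RHS]e00; ring.
  - by rewrite -[RHS]oppr0 -[in RHS]e01; ring.
  - by rewrite -[RHS]oppr0 -[in RHS]e00; ring.
  - by ring.
  - by rewrite -[RHS]e10; ring.
  - by rewrite -[RHS]e01; ring.
  - by rewrite -[RHS]oppr0 -[in RHS]e10; ring.
  - by ring.
have E i j : (traceless_coefs A)`_i * (traceless_coefs B)`_j -
              (traceless_coefs B)`_i * (traceless_coefs A)`_j = 0.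
  by rewrite AB subrr.
have := E 0%N 1%N; have := E 0%N 2%N; have := E 1%N 2%N => /= e12 e02 e01.
apply: matrix2P; rewrite !mulmx2E; apply/eqP; rewrite -subr_eq0; apply/eqP.
- by rewrite -[RHS]e01; ring.
- by rewrite -[RHS]oppr0 -[in RHS]e02; ring.
- by rewrite -[RHS]e12; ring.
- by rewrite -[RHS]oppr0 -[in RHS]e01; ring.
Qed.

Lemma comm_mx2_trans A B C : ~~ is_scalar_mx B ->
  A *m B = B *m A -> B *m C = C *m B -> A *m C = C *m A.
Proof.
move=> nB /comm_mx2P AB /comm_mx2P BC; apply/comm_mx2P => i j.
have [k nk] : exists k, (traceless_coefs B)`_k != 0.
  apply: contrapT => nex; case/negP: nB; apply: is_scalar_mx2P => k.
  by apply/eqP; apply: contrapT => /negP nk; apply: nex; exists k.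
apply: (mulIf nk).
by rewrite mulrAC AB mulrAC BC -[RHS]mulrA AB mulrA.
Qed.

Lemma is_scalar_mx2Z (c : R) A :
  c != 0 -> is_scalar_mx (c *: A) -> is_scalar_mx A.
Proof.
move=> c0 /is_scalar_mxP[d cA].
have E i j : c * A i j = (d%:M : 'M_2) i j by rewrite -cA mxE.
apply: is_scalar_mx2P => -[|[|[|k]]] /=; rewrite ?nth_nil //;
  apply: (mulfI c0).
- by rewrite E !mxE mulr0.
- by rewrite E !mxE mulr0.
- by rewrite mulr0 mulrBr !E !mxE subrr.
Qed.

End TwoByTwo.

Section LetterMatrices.
Local Open Scope ring_scope.
Variable A : countType.
Implicit Types (s : A * bool) (w : seq (A * bool)).

Definition slope s : int := ((pickle s.1).*2 + s.2)%N%:Z.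

Lemma slope_inj : injective slope.
Proof.
move=> [a e] [b f] [] /= E; rewrite /slope /= in E.
have ef : e = f by move: E; case: e; case: f => //=; lia.
by rewrite ef in E *; congr pair; apply: (pcan_inj pickleK); lia.
Qed.

Definition slope_col s : 'cV[int]_2 := \col_i (if i == 0 then 1 else slope s).

Definition slope_row s : 'rV[int]_2 :=
  \row_j ((if s.2 then -1 else 1) *
          if j == 0 then slope (letter_inv s) else -1).

(* The projection onto the line of slope [slope s] along the line of slope
   [slope (letter_inv s)]; it is integral because these slopes differ by 1. *)
Definition slope_proj s : 'M[int]_2 := slope_col s *m slope_row s.

(* Only invertible up to a power of ['X], which keeps ['X = 0] available as a
   specialization. *)
Definition letter_mx s : 'M[{poly int}]_2 :=
  map_mx polyC (slope_proj s) + 'X *: map_mx polyC (slope_proj (letter_inv s)).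

Definition word_mx w : 'M[{poly int}]_2 :=
  foldr (fun s M => letter_mx s *m M) 1%:M w.

Lemma slope_row_col s t :
  slope_row s *m slope_col t =
  ((if s.2 then -1 else 1) * (slope (letter_inv s) - slope t))%:M.
Proof.
apply/matrixP => i j; rewrite !ord1 !mxE !big_ord_recl big_ord0 !mxE /=.
by rewrite mulr1n; ring.
Qed.

Lemma slope_proj_inv s : slope_proj s *m slope_proj (letter_inv s) = 0.
Proof.
rewrite /slope_proj mulmxA -(mulmxA (slope_col s)) slope_row_col subrr mulr0.
by rewrite raddf0 mulmx0 mul0mx.
Qed.

Lemma slope_projD s : slope_proj s + slope_proj (letter_inv s) = 1%:M.
Proof.
case: s => a e.
have slopeT : slope (a, true) = slope (a, false) + 1 by rewrite /slope /=; lia.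
by apply: matrix2P; rewrite !mxE !big_ord1 !mxE /=; case: e;
  rewrite /letter_inv /= ?slopeT ?mulr1n ?mulr0n; ring.
Qed.

Lemma slope_proj_id s : slope_proj s *m slope_proj s = slope_proj s.
Proof.
have := congr1 (mulmx (slope_proj s)) (slope_projD s).
by rewrite mulmxDr slope_proj_inv addr0 mulmx1.
Qed.

Lemma letter_mxV s : letter_mx s *m letter_mx (letter_inv s) = 'X%:M.
Proof.
rewrite /letter_mx letter_invK mulmxDl !mulmxDr -!scalemxAl -!scalemxAr.
rewrite -!map_mxM.
have pi := slope_proj_inv (letter_inv s); rewrite letter_invK in pi.
rewrite pi slope_proj_inv !slope_proj_id !map_mx0 !scaler0 add0r addr0.
by rewrite -scalerDr -map_mxD slope_projD map_mx1 scalemx1.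
Qed.

Lemma word_mx_push s w : exists2 j,
  letter_mx s *m word_mx w = 'X^j *: word_mx (push_letter s w) &
  (size (push_letter s w) + j.*2 = (size w).+1)%N.
Proof.
case: w => [|t w]; first by exists 0%N; rewrite ?expr0 ?scale1r.
rewrite /push_letter; case: eqP => [->|_].
  exists 1%N; rewrite ?addn2 //= mulmxA letter_mxV expr1.
  by rewrite mul_scalar_mx.
by exists 0%N; rewrite ?addn0 // expr0 scale1r.
Qed.

Lemma word_mx_mul w x : exists2 j,
  word_mx w *m word_mx x = 'X^j *: word_mx (word_mul w x) &
  (size (word_mul w x) + j.*2 = size w + size x)%N.
Proof.
elim: w => [|s w [j wx sz]].
  by exists 0%N; rewrite ?addn0 //= mul1mx expr0 scale1r.
have [k push szk] := word_mx_push s (word_mul w x).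
exists (j + k)%N => /=; last first.
  by move: szk sz => /=; rewrite -/(word_mul w x); lia.
by rewrite -mulmxA wx -scalemxAr push scalerA -exprD.
Qed.

Lemma word_mx_at0 s w : reduced (s :: w) ->
  exists2 r : 'rV_2, r != 0 &
    map_mx (horner_eval 0) (word_mx (s :: w)) = slope_col s *m r.
Proof.
have at0 t : map_mx (horner_eval 0) (letter_mx t) = slope_proj t.
  by apply/matrixP => i j; rewrite !mxE horner_evalE !hornerE.
have row_neq0 t : slope_row t != 0.
  apply/eqP => /matrixP /(_ 0 1); rewrite !mxE /=; case: t.2; lia.
elim: w s => [|t w IHw] s.
  by exists (slope_row s); rewrite //= mulmx1 at0.
case/andP=> nts /IHw[r r0 tw].
exists ((slope_row s *m slope_col t) 0 0 *: r); last first.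
  rewrite [word_mx _]/= map_mxM -/(word_mx (t :: w)) tw at0 -mulmxA.
  rewrite (mulmxA (slope_row s)).
  by rewrite {1}[slope_row s *m _]mx11_scalar mul_scalar_mx.
rewrite scalemx_eq0 negb_or r0 andbT slope_row_col mxE mulr1n mulf_neq0 //.
  by case: s.2.
by rewrite subr_eq0; apply: contraNneq nts => /slope_inj ->.
Qed.

Lemma word_mx_nonscalar w :
  reduced w -> w <> [::] -> ~~ is_scalar_mx (word_mx w).
Proof.
case: w => [//|s w] /word_mx_at0[r r0 E] _; apply/is_scalar_mxP => -[c wc].
move: E; rewrite wc map_scalar_mx => E; case/eqP: r0.
have rE i j : slope_col s i 0 * r 0 j = (horner_eval 0 c)%:M i j.
  by rewrite E [RHS]mxE big_ord1.
have r1 : r 0 1 = 0 by have := rE 0 1; rewrite !mxE /= mul1r mulr0n.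
have c0 : horner_eval 0 c = 0 by have := rE 1 1; rewrite r1 mulr0 mxE /= mulr1n.
have r00 : r 0 0 = 0 by have := rE 0 0; rewrite c0 !mxE /= mul1r mulr1n.
apply/matrixP => i j; rewrite ord1 mxE.
by case: (splitP (j : 'I_(1 + 1))) => k; rewrite ord1 => jk;
  [rewrite -r00 | rewrite -r1]; congr (r _ _); apply: ord_inj.
Qed.

End LetterMatrices.

Section FreeCommute.
Variable A : countType.
Implicit Types f g h : free_group A.
Local Open Scope group_scope.

Lemma commute_word_mx f g : commute f g <->
  (word_mx f *m word_mx g = word_mx g *m word_mx f)%R.
Proof.
have [j fg szfg] := word_mx_mul f g; have [k gf szgf] := word_mx_mul g f.
split=> [cfg | cfg].
  have E : word_mul f g = word_mul g f := congr1 val cfg.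
  rewrite E in fg szfg; rewrite fg gf; congr ('X^_ *: _)%R.
  apply: double_inj; apply: (@addnI (size (word_mul g f))).
  by rewrite szfg szgf addnC.
apply: (mulgI (f * g)^-1); rewrite mulVg; apply/esym/val_inj => /=.
apply: contrapT => /(word_mx_nonscalar (free_wordP ((f * g)^-1 * (g * f)))).
case/negP.
have [a Ea _] := word_mx_mul ((f * g)^-1) (g * f).
have [b Eb _] := word_mx_mul ((f * g)^-1) (f * g).
rewrite (_ : word_mul _ (f * g) = [::]) in Eb; last exact: word_mulV.
apply: (@is_scalar_mx2Z _ ('X^(k + a))%R).
  by rewrite expf_neq0 ?polyX_eq0.
rewrite exprD -scalerA -Ea scalemxAr -gf -cfg fg -scalemxAr Eb.
by rewrite !scale_scalar_mx scalar_mx_is_scalar.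
Qed.

Lemma free_commute_trans f g h :
  g <> 1 -> commute f g -> commute g h -> commute f h.
Proof.
move=> g1 /commute_word_mx fg /commute_word_mx gh; apply/commute_word_mx.
apply: comm_mx2_trans fg gh; apply: word_mx_nonscalar (free_wordP g) _.
by move=> g0; apply: g1; apply: val_inj.
Qed.

Lemma word_mul_cat (w x : seq (A * bool)) :
  reduced (w ++ x) -> word_mul w x = w ++ x.
Proof.
elim: w => [//|u w IHw] /= r; rewrite IHw; last exact: path_sorted r.
by case: (w ++ x) r => //= v y /andP[/negPf ->].
Qed.

(* Conjugating [f] by two distinct letters that cancel neither end of [f] gives
   words whose concatenations, in either order, are reduced and start with
   different letters. *)
Lemma free_conj_noncommute (a1 a2 : A) f :
  a1 <> a2 -> f <> 1 -> exists g h, ~ commute (f ^ g) (f ^ h).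
Proof.
move=> a12 f1.
have [s [w fE]] : exists s w, free_word f = s :: w.
  case E : (free_word f) => [|s w]; last by exists s, w.
  by case: f1; apply: val_inj.
pose t := letter_inv (last s w).
have [u [v [uv [us ut] [vs vt]]]] : exists u v : A * bool,
    [/\ u != v, u != s /\ u != t & v != s /\ v != t].
  pose L := [:: (a1, true); (a1, false); (a2, true); (a2, false)].
  have uL : uniq L.
    rewrite /= !inE !xpair_eqE !eqxx /= !andbF !andbT !orbF.
    by rewrite !(introF eqP a12).
  have size_rem_ge (l : A * bool) M : size M <= (size (rem l M)).+1.
    by have [/size_rem ->|/rem_id ->] := boolP (l \in M); rewrite // leqSpred.
  have : 4 <= (size (rem t (rem s L))).+2.
    by apply: leq_trans (size_rem_ge s L) _; rewrite ltnS size_rem_ge.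
  have in_rem l : l \in rem t (rem s L) -> l != s /\ l != t.
    by rewrite !mem_rem_uniq ?rem_uniq // inE mem_rem_uniq // inE => /and3P[].
  have := rem_uniq t (rem_uniq s uL); move: in_rem.
  case: (rem t _) => [|u [|v M]] //= in_rem.
  rewrite inE negb_or => /andP[/andP[uv _] _] _.
  by exists u, v; split=> //; apply: in_rem; rewrite !inE eqxx ?orbT.
pose lt (l : A * bool) : free_group A := FreeGroup (isT : reduced [:: l]).
have conj_red l : l != s -> l != t ->
    reduced (letter_inv l :: rcons (s :: w) l).
  move=> ls lt'; rewrite /= letter_invK eq_sym ls rcons_path lt' andbT.
  by have := free_wordP f; rewrite fE.
have conj_lt l : l != s -> l != t ->
    free_word (f ^ lt l) = letter_inv l :: rcons (s :: w) l.
  move=> ls lt'; have r := conj_red l ls lt'.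
  change (word_mul [:: letter_inv l] (word_mul f [:: l]) =
          letter_inv l :: rcons (s :: w) l).
  have -> : word_mul f [:: l] = rcons (s :: w) l.
    by rewrite fE word_mul_cat cats1 //; apply: path_sorted r.
  exact: word_mul_cat.
have mul_lt l l' : l != l' -> l != s -> l != t -> l' != s -> l' != t ->
    free_word (f ^ lt l * f ^ lt l') =
    (letter_inv l :: rcons (s :: w) l) ++ letter_inv l' :: rcons (s :: w) l'.
  move=> ll' ls lt1 l's l't.
  change (word_mul (free_word (f ^ lt l)) (free_word (f ^ lt l')) =
    (letter_inv l :: rcons (s :: w) l) ++ letter_inv l' :: rcons (s :: w) l').
  rewrite !conj_lt // word_mul_cat // /reduced cat_cons /= cat_path last_rcons.
  have := conj_red l ls lt1; have := conj_red l' l's l't => /= -> /andP[-> ->].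
  by rewrite /= andbT; apply: contraNneq ll' => /(inv_inj (@letter_invK A)) ->.
exists (lt u), (lt v); move=> cuv; have := congr1 (@free_word A) cuv.
have vu : v != u by rewrite eq_sym.
rewrite !mul_lt // => -[e1 /negb_inj e2 _]; move/eqP: uv; apply.
by rewrite [u]surjective_pairing e1 e2 -surjective_pairing.
Qed.

End FreeCommute.

Section Generation.
Local Open Scope group_scope.
Local Open Scope classical_set_scope.
Variable G : groupType.
Implicit Types (X H : set G) (x y g h : G).

Lemma generated_ind X H : generated X = [set: G] -> subgroup H -> X `<=` H ->
  forall g, H g.
Proof.
move=> XG sH XH g; apply: (smallest_sub sH XH).
by rewrite -/(generated X) XG.
Qed.

Lemma normal_closure_normal X : normal_subgroup (normal_closure X).
Proof.
split; first split.
- by move=> H [[[H1 _ _] _] _].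
- move=> x y Nx Ny H HX; have [[[_ HM _] _] _] := HX.
  by apply: HM; [apply: Nx | apply: Ny].
- move=> x Nx H HX; have [[[_ _ HV] _] _] := HX.
  by apply: HV; apply: Nx.
- move=> x g Nx H HX; have [[_ HJ] _] := HX.
  by apply: HJ; apply: Nx.
Qed.

Lemma normal_closure_gen g : normal_closure (generated [set g]) g.
Proof. by apply: sub_gen_smallest; apply: sub_gen_smallest. Qed.

Lemma normal_commg H x y : normal_subgroup H -> H x \/ H y -> H [~ x, y].
Proof.
move=> [[_ HM HV] HJ] [Hx | Hy]; [rewrite commgEl | rewrite commgEr];
  by apply: HM; rewrite -?conjVg; auto.
Qed.

Lemma commuteJ x y z : commute x y -> commute (x ^ z) (y ^ z).
Proof. by rewrite /commute -!conjMg => ->. Qed.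

End Generation.

Section WordLength.
Local Open Scope group_scope.
Local Open Scope classical_set_scope.
Variables (G : groupType) (X : set G).
Hypothesis XG : generated X = [set: G].
Implicit Types (x g h : G) (w : seq G).

Lemma word_of_cat g h w v :
  word_of X g w -> word_of X h v -> word_of X (g * h) (w ++ v).
Proof.
move=> [Xw <-] [Xv <-]; split; last by rewrite big_cat.
by move=> x; rewrite mem_cat => /orP[/Xw|/Xv].
Qed.

Lemma word_of_inv g w :
  word_of X g w -> word_of X g^-1 (rev [seq x^-1 | x <- w]).
Proof.
move=> [Xw <-]; split=> [x|].
  by rewrite mem_rev => /mapP[y /Xw Xy ->]; rewrite invgK; tauto.
elim: w {Xw} => [|x w IHw] /=; first by rewrite !big_nil invg1.
by rewrite rev_cons -cats1 big_cat big_seq1 IHw big_cons invgM.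
Qed.

Lemma word_of_ex g : exists w, word_of X g w.
Proof.
apply: (@generated_ind G X [set g | exists w, word_of X g w]) => //.
  split; first by exists [::]; split; rewrite ?big_nil.
    by move=> x y [w xw] [v yv]; exists (w ++ v); apply: word_of_cat.
  by move=> x [w xw]; exists (rev [seq x^-1 | x <- w]); apply: word_of_inv.
move=> x Xx; exists [:: x]; split; last by rewrite big_seq1.
by move=> y; rewrite inE => /eqP->; left.
Qed.

Lemma word_lengthP g : (exists2 w, word_of X g w & size w = word_length X g) /\
  (forall w, word_of X g w -> word_length X g <= size w)%N.
Proof.
rewrite /word_length; case: xgetP => [k -> //|noK].
have ex : exists k, `[< exists2 w, word_of X g w & size w = k >].
  by have [w gw] := word_of_ex g; exists (size w); apply/asboolP; exists w.
case: (ex_minnP ex) => k /asboolP kw kmin; case: (noK k); split=> // w gw.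
by apply: kmin; apply/asboolP; exists w.
Qed.

Lemma word_length_le g w : word_of X g w -> (word_length X g <= size w)%N.
Proof. by case: (word_lengthP g) => _; apply. Qed.

Lemma word_lengthM g h :
  (word_length X (g * h) <= word_length X g + word_length X h)%N.
Proof.
have [[w gw <-] _] := word_lengthP g; have [[v hv <-] _] := word_lengthP h.
by rewrite -size_cat; apply/word_length_le/word_of_cat.
Qed.

Lemma word_lengthV g : (word_length X g^-1 <= word_length X g)%N.
Proof.
have [[w gw <-] _] := word_lengthP g.
rewrite -(size_map (fun x => x^-1)) -size_rev.
exact/word_length_le/word_of_inv.
Qed.

Lemma word_length_gen x : X x -> (word_length X x <= 1)%N.
Proof.
move=> Xx; apply: (@word_length_le _ [:: x]); split; last by rewrite big_seq1.
by move=> y; rewrite inE => /eqP->; left.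
Qed.

Lemma word_length_gt0 g : g <> 1 -> (0 < word_length X g)%N.
Proof.
by have [[[|x w] [_ <-] <-] _] := word_lengthP g; rewrite ?big_nil.
Qed.

Lemma word_lengthJ x g :
  X x -> (word_length X (g ^ x) <= (word_length X g).+2)%N.
Proof.
move=> Xx; rewrite conjgE; apply: leq_trans (word_lengthM _ _) _.
have x1 := word_length_gen Xx; have xV1 := leq_trans (word_lengthV x) x1.
have gx := leq_trans (word_lengthM g x) (leq_add (leqnn _) x1).
by apply: leq_trans (leq_add xV1 gx) _; rewrite addn1.
Qed.

Lemma word_lengthR g h :
  (word_length X [~ g, h] <= (word_length X g + word_length X h).*2)%N.
Proof.
rewrite commgEl conjgE; apply: leq_trans (word_lengthM _ _) _.
apply: leq_trans (leq_add (leqnn _) (word_lengthM _ _)) _.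
rewrite -addnn addnA; apply: leq_add; last exact: word_lengthM.
by apply: leq_add; apply: word_lengthV.
Qed.

Lemma lcm_length_le S g : common_multiples S g -> g <> 1 ->
  (lcm_length X S <= word_length X g)%N.
Proof.
move=> Sg g1; rewrite /lcm_length; case: xgetP => [k _ [x [Sx x1 xmin] <-]|//].
exact: xmin.
Qed.

End WordLength.

Section CommonMultiples.
Local Open Scope group_scope.
Local Open Scope classical_set_scope.
Variables (A : countType) (a1 a2 : A) (X : set (free_group A)) (d : nat).
Hypothesis (a12 : a1 <> a2) (XG : generated X = [set: free_group A]).

(* Otherwise all the centralizers of [f], [g] and the [g ^ x] coincide, so the
   centralizer of [g] is normalized by [X], hence an abelian normal subgroup. *)
Lemma free_generator_noncommute (f g : free_group A) : f <> 1 -> g <> 1 ->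
  exists2 x, X x & ~ commute f g \/ ~ commute f (g ^ x).
Proof.
move=> f1 g1; apply: contrapT => nex.
have cfg x : X x -> commute f g /\ commute f (g ^ x).
  move=> Xx; split; apply: contrapT => nc; apply: nex; exists x => //; tauto.
have cX x : X x -> commute g (g ^ x).
  move=> /cfg[fg fgx]; apply: free_commute_trans f1 _ fgx.
  exact: commute_sym.
have gJ1 y : g ^ y <> 1 by apply/eqP; rewrite conjg_eq1; apply/eqP.
have cG h : commute g (g ^ h).
  apply: (generated_ind (H := [set h | commute g (g ^ h)]) XG) => //.
  split=> /=.
  - by rewrite conjg1.
  - move=> x y /(commuteJ y) + gy; rewrite -conjgM.
    exact: free_commute_trans (gJ1 y) gy.
  - by move=> x /(commuteJ x^-1); rewrite conjgK => /commute_sym.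
have [h [k []]] := free_conj_noncommute a12 g1.
by apply: free_commute_trans g1 _ (cG k); apply/commute_sym/cG.
Qed.

(* With d = 1, halving the sequence leads to the recursion
   l(p + q) <= 2 (l(p) + l(q) + 2) with |p - q| <= 1 and l(1) <= 1, which
   5 n^2 - 3 satisfies; the summand 3 absorbs the cost of conjugating. *)
Lemma common_multiple_seq (s : seq (free_group A)) : (0 < size s)%N ->
  (forall g, g \in s -> g <> 1 /\ (word_length X g <= d)%N) ->
  exists f, [/\ f <> 1,
    forall g, g \in s -> normal_closure (generated [set g]) f &
    (word_length X f + 3 * d <= 5 * d * size s ^ 2)%N].
Proof.
have [k] := ubnP (size s); elim: k s => // k IHk s sk s0 sd.
have [s1|s2] := leqP (size s) 1.
  case: s s1 s0 sd {sk} => [|g [|//]] // _ _ sd; exists g.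
  have [g1 gd] := sd g (mem_head _ _); split=> //; last by rewrite /=; lia.
  by move=> h; rewrite inE => /eqP ->; apply: normal_closure_gen.
set p := (size s)./2.
have st : size (take p s) = p by rewrite size_takel // /p; lia.
have sd' : size (drop p s) = (size s - p)%N by rewrite size_drop.
have [f [f1 sf lf]] : exists f, [/\ f <> 1,
    forall g, g \in take p s -> normal_closure (generated [set g]) f &
    (word_length X f + 3 * d <= 5 * d * p ^ 2)%N].
  have := IHk (take p s); rewrite st; apply; [lia | lia |].
  by move=> g /mem_take; apply: sd.
have [g [g1 sg lg]] : exists f, [/\ f <> 1,
    forall g, g \in drop p s -> normal_closure (generated [set g]) f &
    (word_length X f + 3 * d <= 5 * d * (size s - p) ^ 2)%N].
  have := IHk (drop p s); rewrite sd'; apply; [lia | lia |].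
  by move=> g /mem_drop; apply: sd.
have [h [fh sh lh]] : exists h, [/\ ~ commute f h,
    forall g, g \in drop p s -> normal_closure (generated [set g]) h &
    (word_length X h <= (word_length X g).+2)%N].
  have [x Xx [nc|nc]] := free_generator_noncommute f1 g1.
    by exists g; split=> //; lia.
  exists (g ^ x); split=> //; last exact: word_lengthJ.
  move=> k0 /sg.
  by case: (normal_closure_normal (generated [set k0])) => _; apply.
have d0 : (0 < d)%N.
  case: (s) s0 sd => // g0 s' _ /(_ g0 (mem_head _ _))[g01 g0d].
  exact: leq_trans (word_length_gt0 XG g01) g0d.
exists [~ f, h]; split.
- by move=> /eqP/commgP.
- move=> k0; rewrite -{1}(cat_take_drop p s) mem_cat => /orP[/sf|/sh] k0N;
  by apply: normal_commg (normal_closure_normal _) _; auto.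
- have lR := word_lengthR XG f h.
  have n2 : size s = p.*2 \/ size s = p.*2.+1 by rewrite /p; lia.
  case: n2 => n2; rewrite n2 in lg *.
    by rewrite (_ : p.*2 - p = p)%N in lg; nia.
  by rewrite (_ : p.*2.+1 - p = p.+1)%N in lg; nia.
Qed.

End CommonMultiples.

Local Open Scope classical_set_scope.

Theorem proposition4p1 (m n d : nat) (X : set (free_group 'I_m))
    (gamma : 'I_n -> free_group 'I_m)
    (m_ge2 : 2 <= m) (n_gt0 : 0 < n)
    (X_finite : finite_set X) (X_gen : generated X = [set: free_group 'I_m])
    (gamma_neq1 : forall j, gamma j <> 1%g)
    (gamma_le : forall j, word_length X (gamma j) <= d) :
  lcm_length X (range gamma) <= 6 * d * n ^ 2.
Proof.
have i01 : Ordinal (ltnW m_ge2) <> Ordinal m_ge2 by [].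
have [||f [f1 sf lf]] :=
  common_multiple_seq i01 X_gen (d := d) (s := codom gamma).
- by rewrite size_codom card_ord.
- by move=> g /codomP[j ->].
have Sf : common_multiples (range gamma) f.
  by move=> g [j _ <-]; apply: sf; apply: codom_f.
apply: leq_trans (lcm_length_le X Sf f1) _.
rewrite size_codom card_ord in lf.
by apply: leq_trans (leq_addr _ _) (leq_trans lf _); rewrite !leq_mul.
Qed.
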